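(* Let $(X,G)$ be a $G$-metric space, let $m\ge 1$, let $X_1,\dots,X_m$ be nonempty subsets of $X$, and let $T:\bigcup_{i=1}^m X_i\to\bigcup_{i=1}^m X_i$ be a G-Mohseni-semi cyclical operator. Then for every $\epsilon>0$, $F_G^{\epsilon}(T)\neq\emptyset$.
   Context: A $G$-metric on a nonempty set $X$ is a function $G:X\times X\times X\to[0,\infty)$ such that: (G1) $G(x,y,z)=0$ if and only if $x=y=z$; (G2) $0<G(x,x,y)$ for all $x,y\in X$ with $x\neq y$; (G3) $G(x,x,y)\le G(x,y,z)$ for all $x,y,z\in X$ with $z\ne y$; (G4) $G$ is symmetric in its three variables (invariant under all permutations of its arguments); (G5) $G(x,y,z)\le G(x,a,a)+G(a,y,z)$ for all $x,y,z,a\in X$. The pair $(X,G)$ is called a $G$-metric space (completeness is not assumed). With the convention $X_{m+1}=X_1$, a map $T:\bigcup_{i=1}^m X_i\to\bigcup_{i=1}^m X_i$ is a cyclical operator if $T(X_i)\subseteq X_{i+1}$ for all $i=1,\dots,m$. A G-Mohseni-semi cyclical operator is a cyclical operator $T$ for which there exists $\alpha\in(0,\frac12)$ such that for all $i\in\{1,\dots,m\}$, $x\in X_i$, $y\in X_{i+1}$, $$G(Tx,Ty,Ty)+G(Ty,Tx,Tx)\le \alpha\,\big([G(x,y,y)+G(y,x,x)]+[G(x,Tx,Tx)+G(Tx,x,x)]\big).$$ For $\epsilon>0$, $F_G^{\epsilon}(T)$ denotes the set of $\epsilon$-fixed points of $T$, i.e. the set of $x\in\bigcup_{i=1}^m X_i$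 with $G(x,Tx,Tx)+G(Tx,x,x)<\epsilon$. *)

(* Defs.v *)
From mathcomp Require Import all_boot all_order all_algebra.
From mathcomp Require Import all_classical reals.

Set Implicit Arguments.
Unset Strict Implicit.
Unset Printing Implicit Defensive.

Import Order.TTheory GRing.Theory Num.Theory.

Local Open Scope classical_set_scope.
Local Open Scope ring_scope.

Record is_Gmetric (R : realType) (X : Type) (G : X -> X -> X -> R) : Prop := {
  Gmetric_nonempty : [set: X] !=set0;
  Gmetric_ge0 : forall x y z, 0 <= G x y z;
  Gmetric_eq0 : forall x y z, G x y z = 0 <-> x = y /\ y = z;
  Gmetric_gt0 : forall x y, x <> y -> 0 < G x x y;
  Gmetric_le : forall x y z, z <> y -> G x x y <= G x y z;
  Gmetric_sym : forall x y z,
    [/\ G x y z = G x z y, G x y z = G y x z, G x y z = G y z x,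
        G x y z = G z x y & G x y z = G z y x];
  Gmetric_triangle : forall x y z a, G x y z <= G x a a + G a y z
}.

(* Indices run over 0, ..., m - 1, and [ordS] is the successor modulo m, which
   realizes the convention X_{m+1} = X_1. *)
Definition cyclic_union (X : Type) (m : nat) (X_ : 'I_m -> set X) : set X :=
  \bigcup_i X_ i.

(* Elements of the union are elements of the subtype [set_type (cyclic_union X_)]
   (by coercion); [val] is its inclusion into X. *)
Definition cyclical_operator (X : Type) (m : nat) (X_ : 'I_m -> set X)
    (T : cyclic_union X_ -> cyclic_union X_) : Prop :=
  forall (i : 'I_m) (x : cyclic_union X_),
    X_ i (val x) -> X_ (ordS i) (val (T x)).

Definition G_Mohseni_semi_cyclical (R : realType) (X : Type)
    (G : X -> X -> X -> R) (m : nat) (X_ : 'I_m -> set X)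
    (T : cyclic_union X_ -> cyclic_union X_) : Prop :=
  cyclical_operator T /\
  exists alpha : R, 0 < alpha < 1 / 2 /\
    forall (i : 'I_m) (x y : cyclic_union X_),
      X_ i (val x) -> X_ (ordS i) (val y) ->
      G (val (T x)) (val (T y)) (val (T y)) +
      G (val (T y)) (val (T x)) (val (T x)) <=
      alpha * ((G (val x) (val y) (val y) + G (val y) (val x) (val x)) +
               (G (val x) (val (T x)) (val (T x)) +
                G (val (T x)) (val x) (val x))).

Definition eps_fixed_points (R : realType) (X : Type)
    (G : X -> X -> X -> R) (m : nat) (X_ : 'I_m -> set X)
    (T : cyclic_union X_ -> cyclic_union X_) (eps : R) :
    set (cyclic_union X_) :=
  [set x | G (val x) (val (T x)) (val (T x)) +
           G (val (T x)) (val x) (val x) < eps].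

(* Main.v *)
Require Import Defs.
From mathcomp Require Import all_boot all_order all_algebra.
From mathcomp Require Import all_classical reals.
From mathcomp Require Import lra.

(** Write d(x) = G(x,Tx,Tx) + G(Tx,x,x) for the displacement of x. If x lies in
    X_i then Tx lies in X_{i+1}, so y = Tx is admissible in the contraction
    condition; there both brackets on the right equal d(x), and the condition
    becomes d(Tx) <= 2 alpha d(x) with 2 alpha < 1
    ([displacement_contraction]). A real function that a self-map shrinks by a
    factor k < 1 has no positive lower bound, for a positive infimum would be
    beaten by the image of a near-minimizer ([contracted_fun_small]). Hence d
    takes values below every eps > 0. *)

Import Order.TTheory GRing.Theory Num.Theory.

Local Open Scope classical_set_scope.
Local Open Scope ring_scope.

(** If all values were at least [eps], their infimum [l] would be positive,
    hence [l < l / k], and some [f x < l / k]; then [f (T x) <= k * f x < l]. *)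
Lemma contracted_fun_small (R : realType) (S : Type) (T : S -> S) (f : S -> R)
    (k : R) (x0 : S) :
  0 < k < 1 -> (forall x, f (T x) <= k * f x) ->
  forall eps, 0 < eps -> exists x, f x < eps.
Proof.
move=> /andP[k_gt0 k_lt1] fT eps eps_gt0; apply: contrapT => no_small.
have f_ge x : eps <= f x.
  by rewrite leNgt; apply/negP => fx_lt; apply: no_small; exists x.
have f_lb : has_lbound (range f) by exists eps => _ [x _ <-].
have f_inf : has_inf (range f) by split=> //; exists (f x0), x0.
have l_gt0 : 0 < inf (range f).
  apply: (lt_le_trans eps_gt0); apply: lb_le_inf; first by exists (f x0), x0.
  by move=> _ [x _ <-].
have gap_gt0 : 0 < inf (range f) / k - inf (range f).
  by rewrite subr_gt0 ltr_pdivlMr // gtr_pMr.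
have [_ [x _ <-]] := inf_adherent gap_gt0 f_inf.
rewrite addrC subrK ltr_pdivlMr // mulrC => fx_lt.
have : inf (range f) <= f (T x) by apply: ge_inf => //; exists (T x).
by rewrite leNgt (le_lt_trans (fT x) fx_lt).
Qed.

Lemma displacement_contraction (R : realType) (X : Type) (G : X -> X -> X -> R)
    (m : nat) (X_ : 'I_m -> set X) (T : cyclic_union X_ -> cyclic_union X_) :
  G_Mohseni_semi_cyclical G T ->
  let d x := G (val x) (val (T x)) (val (T x)) +
             G (val (T x)) (val x) (val x) in
  exists2 k : R, 0 < k < 1 & forall x, d (T x) <= k * d x.
Proof.
move=> [Tcyc [alpha [/andP[alpha_gt0 alpha_lt] contr]]] d.
exists (2 * alpha); first by apply/andP; split; lra.
move=> x; have [i _ Xix] := set_valP x.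
have := contr i x (T x) Xix (Tcyc i x Xix); rewrite -/(d x) -/(d (T x)).
by rewrite mulrDr -mulrA mulr_natl mulr2n.
Qed.

Theorem theorem4p14 (R : realType) (X : Type) (G : X -> X -> X -> R)
    (HG : is_Gmetric G) (m : nat) (Hm : (1 <= m)%N) (X_ : 'I_m -> set X)
    (HX : forall i : 'I_m, X_ i !=set0)
    (T : cyclic_union X_ -> cyclic_union X_)
    (HT : G_Mohseni_semi_cyclical G T) (eps : R) (Heps : 0 < eps) :
  eps_fixed_points G T eps !=set0.
Proof.
have [p Xp] := HX (Ordinal Hm).
have Up : cyclic_union X_ p by exists (Ordinal Hm).
have [k k01 dT] := @displacement_contraction R X G m X_ T HT.
have [x dx] := @contracted_fun_small R _ T _ k (SigSub (mem_set Up)) k01 dT eps Heps.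
by exists x.
Qed.
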